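(* Let $n\geq 3$ be an integer and let $p(z)=z^n+a_{n-1}z^{n-1}+a_{n-2}z^{n-2}+\ldots+a_1z+a_0$ be a monic polynomial with complex coefficients and $a_0\neq 0$. If $z\in\mathbb{C}$ is any zero of $p$, then \[|z|\leq \cos \frac{\pi}{n}+ \frac{1}{2} \left ( |a_{n-1}|+ \sqrt{(1+|a_{n-2}|)^2+ \sum_{j=0,\,j\neq n-2}^{n-1}|a_j|^2}\right).\] *)

(* Defs.v *)
From HB Require Import structures.
From mathcomp Require Export all_boot all_order all_algebra.
From mathcomp Require Export complex.
From mathcomp Require Export reals trigo.

Set Implicit Arguments.
Unset Strict Implicit.
Unset Printing Implicit Defensive.

(* The norm [`|z|] of [z : R[i]] is an element of [R[i]]; [cmod z] is the same
   modulus as an element of [R]. *)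
Notation cmod := ComplexField.Normc.normc.

(* Main.v *)
(** Write r = |z|. The vector y with entries y_j = r^j, 0 <= j < n, turns
    |p(z) - z^n| = r^n into an estimate of r * |y|^2 by the quadratic form of
    the companion matrix with entries replaced by moduli.  That form is split in
    two by moving the entry 1 joining y_(n-2) and y_(n-1) from the shift to the
    row of coefficients.  What remains of the shift has size n-1, hence numerical
    radius cos (pi / n); the enlarged row, with diagonal entry A = |a_(n-1)| and
    other entries of norm S, has numerical radius (A + sqrt (A^2 + S^2)) / 2. *)
Require Import Defs.
From mathcomp Require Import ring lra.

Import Order.TTheory GRing.Theory Num.Theory.

Local Open Scope ring_scope.

(* The weights [sin (k * x)] form the Perron vector of the path: AM-GM on each
   product [y k * y k.+1] with these weights telescopes, by
   [sin (k * x) + sin (k.+2 * x) = 2 * cos x * sin (k.+1 * x)]. *)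
Lemma shift_form_partial (R : realType) (x : R) (m : nat) (y : nat -> R) (k : nat) :
  (forall j, (0 < j <= m.+1)%N -> 0 < sin (j%:R * x)) -> (k <= m)%N ->
  \sum_(j < k) y j * y j.+1 <=
    cos x * \sum_(j < k) y j ^+ 2
    + sin (k%:R * x) / (2 * sin (k.+1%:R * x)) * y k ^+ 2.
Proof.
move=> sin_gt0; elim: k => [|k IHk] km.
  by rewrite !big_ord0 mul0r sin0 mul0r mul0r mulr0 addr0.
rewrite !big_ord_recr /=; have := IHk (ltnW km).
have s1 := sin_gt0 k.+1 (ltnW km : (0 < k.+1 <= m.+1)%N).
have s2 := sin_gt0 k.+2 (km : (0 < k.+2 <= m.+1)%N).
have recS : sin (k%:R * x) = 2 * cos x * sin (k.+1%:R * x) - sin (k.+2%:R * x).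
  have -> : k%:R * x = k.+1%:R * x - x by rewrite -natr1; ring.
  have -> : k.+2%:R * x = k.+1%:R * x + x by rewrite -[k.+2%:R]natr1; ring.
  by rewrite sinB sinD; ring.
rewrite recS.
set s := sin (k.+1%:R * x) in s1 *; set s' := sin (k.+2%:R * x) in s2 *.
have : 0 <= (s' * y k - s * y k.+1) ^+ 2 / (2 * s * s').
  by rewrite divr_ge0 ?sqr_ge0// !mulr_ge0// ltW.
have -> : (s' * y k - s * y k.+1) ^+ 2 / (2 * s * s') =
    s' / (2 * s) * y k ^+ 2 - y k * y k.+1 + s / (2 * s') * y k.+1 ^+ 2.
  by field; rewrite !gt_eqF.
(* The negative part cancels the [y k ^+ 2] term of the square above, which leaves the weight
   [cos x]. *)
have -> : (2 * cos x * s - s') / (2 * s) = cos x - s' / (2 * s).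
  by field; rewrite gt_eqF.
by rewrite mulrDr mulrBl; lra.
Qed.

(** At this angle [sin (m.+2%:R * x)] vanishes, so the boundary coefficient of [shift_form_partial]
    at [k = m] is exactly [cos x] and supplies the last square. *)
Lemma shift_form_le (R : realType) (m : nat) (y : nat -> R) :
  \sum_(j < m) y j * y j.+1 <= cos (pi / m.+2%:R) * \sum_(j < m.+1) y j ^+ 2.
Proof.
set x := pi / _.
have m2x : m.+2%:R * x = pi by rewrite mulrC divfK// pnatr_eq0.
have x0 : 0 < x by rewrite divr_gt0 ?pi_gt0.
have sin_gt0 j : (0 < j <= m.+1)%N -> 0 < sin (j%:R * x).
  move=> /andP[j0 jm]; apply: sin_gt0_pi.
  by rewrite mulr_gt0 ?ltr0n//= -m2x ltr_pM2r// ltr_nat.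
have := shift_form_partial _ _ _ y _ sin_gt0 (leqnn m).
have s1 := sin_gt0 m.+1 (leqnn _).
have -> : sin (m%:R * x) = 2 * cos x * sin (m.+1%:R * x).
  have -> : m%:R * x = m.+1%:R * x - x by rewrite -natr1; ring.
  have : sin (m.+1%:R * x + x) = 0.
    by rewrite -[X in _ + X]mul1r -mulrDl natr1 m2x sinpi.
  by rewrite sinB sinD; lra.
rewrite big_ord_recr /= mulrDr.
suff -> : 2 * cos x * sin (m.+1%:R * x) / (2 * sin (m.+1%:R * x)) = cos x by [].
by field; rewrite gt_eqF.
Qed.

(* The hypothesis says that [l] is a root of the characteristic equation of the
   form; clearing the factor [4 * l] leaves a sum of squares. *)
Lemma row_form_le (R : realFieldType) (m : nat) (b y : nat -> R) (A t l : R) :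
  0 < l -> 4 * l * (l - A) = \sum_(j < m) b j ^+ 2 ->
  A * t ^+ 2 + (\sum_(j < m) b j * y j) * t <=
    l * (\sum_(j < m) y j ^+ 2 + t ^+ 2).
Proof.
move=> l0 lE.
have : 0 <= \sum_(j < m) (2 * l * y j - b j * t) ^+ 2.
  by apply: sumr_ge0 => j _; apply: sqr_ge0.
have -> : \sum_(j < m) (2 * l * y j - b j * t) ^+ 2 =
    4 * l ^+ 2 * \sum_(j < m) y j ^+ 2
    - 4 * l * t * (\sum_(j < m) b j * y j) + t ^+ 2 * \sum_(j < m) b j ^+ 2.
  rewrite !mulr_sumr -sumrB -big_split /=.
  by apply: eq_bigr => j _; ring.
rewrite -lE => h.
rewrite -(ler_pM2l (_ : 0 < 4 * l)) ?mulr_gt0//.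
by lra.
Qed.

Lemma power_le_sum_bound (R : realType) (m : nat) (a : nat -> R) (r : R) :
  (forall j, 0 <= a j) -> 0 <= r ->
  r ^+ m.+2 <= \sum_(j < m.+2) a j * r ^+ j ->
  r <= cos (pi / m.+2%:R)
    + 2^-1 * (a m.+1 + Num.sqrt ((1 + a m) ^+ 2
        + (\sum_(j < m) a j ^+ 2 + a m.+1 ^+ 2))).
Proof.
move=> a0 r0 hr.
set D := _ + (_ + _); set l := 2^-1 * _.
(* The enlarged row: index [m] is n-2, where the entry 1 taken from the shift is added. *)
pose b (j : nat) := a j + (j == m)%:R.
have bm : b m = 1 + a m by rewrite /b eqxx addrC.
have bE (j : 'I_m) : b j = a j by rewrite /b ltn_eqF ?addr0.
have D1 : 0 < D.
  rewrite /D ltr_pwDl ?exprn_gt0 ?ltr_wpDr//.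
  by rewrite addr_ge0 ?sqr_ge0// sumr_ge0// => j _; apply: sqr_ge0.
have l0 : 0 < l by rewrite /l mulr_gt0 ?invr_gt0// ltr_wpDl// sqrtr_gt0.
(* [l] is the larger root of this quadratic equation, whose discriminant is proportional to [D]. *)
have lE : 4 * l * (l - a m.+1) = \sum_(j < m.+1) b j ^+ 2.
  have -> : 4 * l * (l - a m.+1) = Num.sqrt D ^+ 2 - a m.+1 ^+ 2.
    by rewrite /l; field.
  rewrite sqr_sqrtr ?ltW// big_ord_recr /= bm /D.
  under [in RHS]eq_bigr do rewrite bE.
  by ring.
have := row_form_le _ _ _ (fun j => r ^+ j) _ (r ^+ m.+1) _ l0 lE.
have := shift_form_le _ m (fun j => r ^+ j).
set Y := \sum_(j < m.+1) _ => hshift hrow.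
(* The term [j = 0] is 1, so this holds even for [r = 0]. *)
have Y0 : 0 < Y + (r ^+ m.+1) ^+ 2.
  rewrite ltr_wpDr ?sqr_ge0// /Y big_ord_recl expr0 expr1n ltr_wpDr//.
  by apply: sumr_ge0 => j _; apply: sqr_ge0.
have cos0 : 0 <= cos (pi / m.+2%:R : R).
  have pi0 := pi_gt0 R.
  apply: cos_ge0_pihalf; rewrite ler_pM2l// lef_pV2 ?posrE ?ltr0n// ler_nat.
  rewrite /= andbT (@le_trans _ _ 0)// ?oppr_le0 divr_ge0 ?ltW//.
(* The shift bound involves only the first n-1 squares; this adds the last one to its right side. *)
have hcos : 0 <= cos (pi / m.+2%:R) * (r ^+ m.+1) ^+ 2.
  by rewrite mulr_ge0 ?sqr_ge0.
have rY : r * Y = \sum_(j < m) r ^+ j * r ^+ j.+1 + r ^+ m * r ^+ m.+1.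
  rewrite mulr_sumr [LHS](_ : _ = \sum_(j < m.+1) r ^+ j * r ^+ j.+1).
    by rewrite big_ord_recr.
  by apply: eq_bigr => j _; rewrite (exprS r j); ring.
(* This is [hr] multiplied by the last entry [r ^+ m.+1]. *)
have rt : r * (r ^+ m.+1) ^+ 2 <=
    (\sum_(j < m.+1) a j * r ^+ j) * r ^+ m.+1 + a m.+1 * (r ^+ m.+1) ^+ 2.
  rewrite [leLHS](_ : _ = r ^+ m.+2 * r ^+ m.+1); last first.
    by rewrite (exprS r m.+1); ring.
  rewrite [leRHS](_ : _ = (\sum_(j < m.+2) a j * r ^+ j) * r ^+ m.+1).
    by rewrite ler_wpM2r ?exprn_ge0.
  by rewrite [in RHS]big_ord_recr /=; ring.
have bsum : \sum_(j < m.+1) b j * r ^+ j = \sum_(j < m.+1) a j * r ^+ j + r ^+ m.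
  rewrite !big_ord_recr /= bm.
  under eq_bigr do rewrite bE.
  by ring.
rewrite bsum in hrow.
by rewrite -(ler_pM2r Y0); lra.
Qed.

Lemma cmod_ge0 (R : rcfType) (x : R[i]) : 0 <= cmod x.
Proof. by case: x => u v; apply: sqrtr_ge0. Qed.

Lemma cmodX (R : rcfType) (x : R[i]) (k : nat) : cmod (x ^+ k) = cmod x ^+ k.
Proof.
elim: k => [|k IHk]; first by rewrite !expr0 ComplexField.Normc.normc1.
by rewrite !exprS ComplexField.Normc.normcM IHk.
Qed.

Lemma cmod_sum (R : rcfType) (m : nat) (F : 'I_m -> R[i]) :
  cmod (\sum_i F i) <= \sum_i cmod (F i).
Proof.
elim/big_ind2: _ => [|x x' y y' hx hy|//].
  by rewrite ComplexField.Normc.normc0.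
by apply: le_trans (le_normcD _ _) _; apply: lerD.
Qed.

(** Solve p(z) = 0 for the leading power and apply the triangle inequality. *)
Lemma monic_root_cmod (R : rcfType) (n : nat) (p : {poly R[i]}) (z : R[i]) :
  p \is monic -> size p = n.+1 -> root p z ->
  cmod z ^+ n <= \sum_(j < n) cmod p`_j * cmod z ^+ j.
Proof.
move=> /monicP; rewrite /lead_coef => lp sp /rootP.
rewrite horner_coef sp big_ord_recr /=.
rewrite sp /= in lp; rewrite lp mul1r => /eqP; rewrite addrC addr_eq0 => /eqP zn.
rewrite -cmodX zn normcN; apply: le_trans (cmod_sum _ _ _) _.
by apply: ler_sum => j _; rewrite ComplexField.Normc.normcM cmodX.
Qed.

Theorem theorem2p5 (R : realType) (n : nat) (p : {poly R[i]}) (z : R[i])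
    (hn : (3 <= n)%N)
    (hp : p \is monic) (hdeg : size p = n.+1)
    (ha0 : p`_0 != 0)
    (hz : root p z) :
  cmod z <= cos (pi / n%:R)
    + 2^-1 * (cmod p`_(n - 1)
              + Num.sqrt ((1 + cmod p`_(n - 2)) ^+ 2
                          + \sum_(0 <= j < n | j != (n - 2)%N)
                              cmod p`_j ^+ 2)).
Proof.
have := monic_root_cmod _ _ _ _ hp hdeg hz.
case: n hn hdeg => [//|[//|m]] _ _ hr.
have -> : (m.+2 - 1 = m.+1)%N by rewrite subn1.
have -> : (m.+2 - 2 = m)%N by rewrite subn2.
rewrite big_mkord big_mkcond 2!big_ord_recr /= eqxx addr0 gtn_eqF//=.
under [\sum_(i < m) _]eq_bigr => i _ do rewrite ltn_eqF//=.
exact: (power_le_sum_bound _ _ (fun j => cmod p`_j) _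
          (fun j => cmod_ge0 _ _) (cmod_ge0 _ z) hr).
Qed.
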